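(* Let $\Bbbk$ be a field of characteristic zero and let $\sim$ be a uniformly algebraic word relation. The image of $\widehat{\mathbf K}_{\mathsf P}^{(\sim)}$ under $\tilde\psi_{>|\le}$ is contained in $\widehat{\mathsf{Sym}}$ only if $\sim$ extends Knuth equivalence, $K$-Knuth equivalence, or exotic Knuth equivalence.
   Context: Words. $[n]=\{1,\dots,n\}$; $\mathbb P$ is the set of positive integers. A word is a finite sequence of positive integers; $\ell(w)$ is its length. $w\cap S$ is the subword formed by omitting letters not in $S$. If the set of letters of $w$ has $m$ elements and $\phi$ is the order-preserving bijection from it to $[m]$, then $\mathrm{fl}(w)=\phi(w_1)\phi(w_2)\cdots$; $w$ is packed if $w=\mathrm{fl}(w)$. $\mathbb W_{\mathsf P}$ is the set of packed words. Word relations. A word relation is an equivalence relation on words such that $v\sim w$ only if $v,w$ have the same set of letters (multiplicities may differ). It is uniformly algebraic if for all words $v,w$: (a) $v\sim v'$, $w\sim w'$ imply $vw\sim v'w'$; (b) if $v\sim w$ and $I\subset\mathbb P$ is a set of consecutive integers then $v\cap I\sim w\cap I$; (c) if $v\sim w$ then $\phi(v)\sim\phi(w)$ for any order-preserving injection $\phi:[\min(v),\max(v)]\to\mathbb P$ (integer interval; applied letterwise). A relation $\sim$ extends $\approx$ if $v\approx w$ implies $v\sim w$. The following are the smallest equivalence relations on words that are congruences for concatenation and satisfy the listed relations for all positive integers $a<b<c$ (and $x\le y<z$): Knuth equivalence: $bac\sim bca$, $acb\sim cab$, $aba\sim baa$, $bab\sim bba$. $K$-Knuth equivalence: $bac\sim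 bca$, $acb\sim cab$, $aba\sim bab$, $a\sim aa$. Exotic Knuth equivalence: $bac\sim bca$, $acb\sim cab$, $bba\sim bab\sim abb$, $xyzy\sim yzyx$. Spaces. $\widehat{\mathbf W}_{\mathsf P}$ is the $\Bbbk$-vector space of possibly infinite formal linear combinations of packed words, with the product topology (each coefficient line discrete). For a $\sim$-equivalence class $E\subset\mathbb W_{\mathsf P}$ let $\kappa_E=\sum_{w\in E}w$; $\widehat{\mathbf K}_{\mathsf P}^{(\sim)}\subset\widehat{\mathbf W}_{\mathsf P}$ is the space of all possibly infinite linear combinations of the $\kappa_E$. Quasi-symmetric functions. A composition $\alpha=(\alpha_1,\dots,\alpha_l)\vDash n$ is a sequence of positive integers with sum $n$, $\ell(\alpha)=l$, and $I(\alpha)=\{\alpha_1,\alpha_1+\alpha_2,\dots,\alpha_1+\cdots+\alpha_{l-1}\}\subset[n-1]$. $M_\alpha=\sum_{i_1<\cdots<i_l}x_{i_1}^{\alpha_1}\cdots x_{i_l}^{\alpha_l}$ ($M_\emptyset=1$). $\widehat{\mathsf{QSym}}$ is the space of possibly infinite linear combinations of the $M_\alpha$, with the product topology; $\widehat{\mathsf{Sym}}\subset\widehat{\mathsf{QSym}}$ is the subspace of its symmetric elements (possibly infinite linear combinations of monomial symmetric functions). The map. $\tilde\psi_{>|\le}:\widehat{\mathbf W}_{\mathsf P}\to\widehat{\mathsf{QSym}}$ is the continuous linear map given on a packed word $w=w_1\cdots w_n$ by $\tilde\psi_{>|\le}(w)=K_\alpha$, where $\alpha\vDash n$ is the composition with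 $I(\alpha)=\{i:2\le i\le n-1,\ w_{i-1}\le w_i>w_{i+1}\}$ and $K_\alpha=\sum_{\beta\vDash n,\ I(\alpha)\subset I(\beta)\cup(I(\beta)+1)}2^{\ell(\beta)}M_\beta$. (Equivalently, it is the canonical morphism of linearly compact combinatorial bialgebras to $\widehat{\mathsf{QSym}}$ associated to the character sending $\emptyset\mapsto1$, $w\mapsto2t^m$ if $w_1>\cdots>w_i\le w_{i+1}\le\cdots\le w_m$ for some $1\le i\le m=\ell(w)$, and $w\mapsto0$ otherwise.) *)

(* Defs.v *)
From HB Require Import structures.
From mathcomp Require Import all_boot all_order all_algebra.
From mathcomp Require Import all_classical.
From mathcomp Require Import zify.

Set Implicit Arguments.
Unset Strict Implicit.
Unset Printing Implicit Defensive.

Import GRing.Theory.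
Local Open Scope classical_set_scope.
Local Open Scope nat_scope.

Definition is_word (w : seq nat) : bool := all (leq 1) w.

(* The order-preserving bijection from the letters of w onto [m] sends a to the
   number of distinct letters of w that are at most a. *)
Definition flatten_word (w : seq nat) : seq nat :=
  [seq count (fun b => b <= a) (undup w) | a <- w].

Definition packed (w : seq nat) : bool := flatten_word w == w.

(* A relation on words is represented by R : seq nat -> seq nat -> Prop; only
   its values on sequences satisfying is_word are meaningful, and every
   condition below is restricted to those. *)
Record word_relation (R : seq nat -> seq nat -> Prop) : Prop := WordRelation {
  wrel_refl : forall v, is_word v -> R v v;
  wrel_sym : forall v w, is_word v -> is_word w -> R v w -> R w v;
  wrel_trans : forall u v w, is_word u -> is_word v -> is_word w ->
    R u v -> R v w -> R u w;
  wrel_letters : forall v w, is_word v -> is_word w -> R v w -> v =i w }.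

(* Finite or infinite intervals; intersecting with the positive integers
   changes nothing, as I only serves to select letters of words. *)
Definition consecutive (I : pred nat) : Prop :=
  forall a b c, a <= b <= c -> I a -> I c -> I b.

(* Membership in the integer interval [min v, max v], empty if v is empty. *)
Definition in_range (v : seq nat) (a : nat) : bool :=
  has (fun x => x <= a) v && has (fun x => a <= x) v.

Definition range_injection (v : seq nat) (phi : nat -> nat) : Prop :=
  (forall a, in_range v a -> 0 < phi a) /\
  (forall a b, in_range v a -> in_range v b -> a < b -> phi a < phi b).

Record uniformly_algebraic (R : seq nat -> seq nat -> Prop) : Prop :=
  UniformlyAlgebraic {
  ualg_cat : forall v v' w w',
    is_word v -> is_word v' -> is_word w -> is_word w' ->
    R v v' -> R w w' -> R (v ++ w) (v' ++ w');
  ualg_filter : forall v w (I : pred nat), is_word v -> is_word w ->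
    consecutive I -> R v w -> R [seq a <- v | I a] [seq a <- w | I a];
  ualg_map : forall v w (phi : nat -> nat), is_word v -> is_word w ->
    range_injection v phi -> R v w -> R (map phi v) (map phi w) }.

(* Smallest congruence for concatenation containing G.  The relations G used
   below only relate words with the same letters, so on words this is the
   smallest such congruence on words. *)
Inductive congruence_closure (G : seq nat -> seq nat -> Prop) :
    seq nat -> seq nat -> Prop :=
| cc_gen v w of G v w : congruence_closure G v w
| cc_refl v : congruence_closure G v v
| cc_sym v w of congruence_closure G v w : congruence_closure G w v
| cc_trans u v w of congruence_closure G u v & congruence_closure G v w :
    congruence_closure G u w
| cc_cat v v' w w' of congruence_closure G v v' & congruence_closure G w w' :
    congruence_closure G (v ++ w) (v' ++ w').

Inductive knuth_gen : seq nat -> seq nat -> Prop :=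
| knuth_bac a b c of 0 < a & a < b & b < c :
    knuth_gen [:: b; a; c] [:: b; c; a]
| knuth_acb a b c of 0 < a & a < b & b < c :
    knuth_gen [:: a; c; b] [:: c; a; b]
| knuth_aba a b of 0 < a & a < b : knuth_gen [:: a; b; a] [:: b; a; a]
| knuth_bab a b of 0 < a & a < b : knuth_gen [:: b; a; b] [:: b; b; a].

Inductive Kknuth_gen : seq nat -> seq nat -> Prop :=
| Kknuth_bac a b c of 0 < a & a < b & b < c :
    Kknuth_gen [:: b; a; c] [:: b; c; a]
| Kknuth_acb a b c of 0 < a & a < b & b < c :
    Kknuth_gen [:: a; c; b] [:: c; a; b]
| Kknuth_aba a b of 0 < a & a < b : Kknuth_gen [:: a; b; a] [:: b; a; b]
| Kknuth_aa a of 0 < a : Kknuth_gen [:: a] [:: a; a].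

Inductive exotic_gen : seq nat -> seq nat -> Prop :=
| exotic_bac a b c of 0 < a & a < b & b < c :
    exotic_gen [:: b; a; c] [:: b; c; a]
| exotic_acb a b c of 0 < a & a < b & b < c :
    exotic_gen [:: a; c; b] [:: c; a; b]
| exotic_bba a b of 0 < a & a < b : exotic_gen [:: b; b; a] [:: b; a; b]
| exotic_bab a b of 0 < a & a < b : exotic_gen [:: b; a; b] [:: a; b; b]
| exotic_xyzy x y z of 0 < x & x <= y & y < z :
    exotic_gen [:: x; y; z; y] [:: y; z; y; x].

Definition knuth := congruence_closure knuth_gen.
Definition Kknuth := congruence_closure Kknuth_gen.
Definition exotic_knuth := congruence_closure exotic_gen.

Definition extends (R S : seq nat -> seq nat -> Prop) : Prop :=
  forall v w, is_word v -> is_word w -> S v w -> R v w.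

Definition composition (n : nat) (a : seq nat) : bool :=
  is_word a && (sumn a == n).

Definition comp_set (a : seq nat) : seq nat :=
  [seq sumn (take j a) | j <- iota 1 (size a).-1].

Definition comp_of_set (n : nat) (s : seq nat) : seq nat :=
  if n is 0 then [::] else pairmap (fun i j => j - i) 0 (rcons s n).

Lemma sumn_take_pairmap x s j : sorted leq (x :: s) -> j <= size s ->
  sumn (take j (pairmap (fun i k => k - i) x s)) = nth x (x :: s) j - x.
Proof.
elim: s x j => [|y s IHs] x [|j] //=; rewrite ?subnn // ltnS => /andP[xy ys] js.
rewrite IHs // (set_nth_default x) //.
suff yj : y <= nth x (y :: s) j by rewrite addnC addnBA // subnK.
have /(order_path_min leq_trans)/allP ally := ys.
case: j js => [|j] js //=; exact/ally/mem_nth.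
Qed.

Lemma comp_of_setP n (s : seq nat) :
  sorted ltn s -> all (fun i => 0 < i < n) s ->
  composition n (comp_of_set n s) /\ comp_set (comp_of_set n s) = s.
Proof.
case: n => [|n] ss sn.
  by case: s ss sn => [|i s] //=; rewrite ltn0 andbF.
have s0 : path ltn 0 (rcons s n.+1).
  rewrite rcons_path; apply/andP; split.
    by rewrite path_min_sorted //; apply: sub_all sn => i /andP[].
  case: (lastP s) sn => [|t i] //=.
  by rewrite last_rcons all_rcons => /andP[/andP[]].
have l0 : sorted leq (0 :: rcons s n.+1).
  by apply: sub_path s0 => i j; apply: ltnW.
rewrite /comp_of_set; set d := pairmap _ _ _.
have dsz : size d = (size s).+1 by rewrite size_pairmap size_rcons.
split.
  apply/andP; split.
    rewrite /d; elim: (rcons s n.+1) 0 s0 => [|y t IHt] x //= /andP[xy yt].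
    by rewrite subn_gt0 xy IHt.
  have := @sumn_take_pairmap 0 _ (size s).+1 l0.
  rewrite size_rcons leqnn => /(_ isT).
  rewrite -/d take_oversize ?dsz // subn0 /= nth_rcons ltnn eqxx => ->.
  exact: eqxx.
apply: (@eq_from_nth _ 0); rewrite /comp_set size_map size_iota dsz //= => i il.
rewrite (nth_map 0) ?size_iota // nth_iota // add1n sumn_take_pairmap //.
  by rewrite subn0 /= nth_rcons il.
by rewrite size_rcons ltnW.
Qed.

Definition letter (w : seq nat) (i : nat) : nat := nth 0 w i.-1.

Definition peaks (w : seq nat) : seq nat :=
  [seq i <- iota 2 (size w - 2) |
    (letter w i.-1 <= letter w i) && (letter w i.+1 < letter w i)].

Definition peak_comp (w : seq nat) : seq nat := comp_of_set (size w) (peaks w).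

Lemma peak_compP w :
  composition (size w) (peak_comp w) /\ comp_set (peak_comp w) = peaks w.
Proof.
apply: comp_of_setP.
  by apply: sorted_filter; [exact: ltn_trans|exact: iota_ltn_sorted].
apply/allP => i; rewrite mem_filter mem_iota => /andP[_ /andP[i2]].
by case: (size w) => [|[|n]]; lia.
Qed.

Local Open Scope ring_scope.

(* The possibly infinite linear combination sum_(i in A) c i * b i of a family
   of functions b, computed coefficientwise.  A sum over A is read as 0 when its
   support is infinite; this never happens below, where for each x only
   finitely many b i have a nonzero coefficient at x. *)
Definition lincomb (k : fieldType) (I : choiceType) (X : Type) (A : set I) (c : I -> k)
    (b : I -> X -> k) : X -> k :=
  fun x => \sum_(i \in A) c i * b i x.

(* An element of the completed space of words is its coefficient function
   seq nat -> k, supported on packed words. *)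
Definition packed_classes (R : seq nat -> seq nat -> Prop) :
    set (set (seq nat)) :=
  [set E | exists2 w, packed w & E = [set v | is_word v /\ R w v]].

Definition kappa (k : fieldType) (E : set (seq nat)) : seq nat -> k :=
  fun w => (w \in E)%:R.

Definition Khat (k : fieldType) (R : seq nat -> seq nat -> Prop) : set (seq nat -> k) :=
  [set f | exists c : set (seq nat) -> k,
    f = lincomb (packed_classes R) c (kappa k)].

(* A power series in x_1, x_2, ... is a function F : seq nat -> k, where
   F [:: e_1; ...; e_N] is the coefficient of x_1^e_1 ... x_N^e_N.  This
   monomial occurs in the monomial quasi-symmetric function of a, with
   coefficient 1, iff its nonzero exponents, read in order, form a. *)
Definition qsym_M (k : fieldType) (a : seq nat) : seq nat -> k :=
  fun e => ([seq x <- e | x != 0%N] == a)%:R.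

Definition QSymhat (k : fieldType) : set (seq nat -> k) :=
  [set F | exists c : seq nat -> k,
    F = lincomb [set a | is_word a] c (qsym_M k)].

(* Two exponent vectors related by perm_eq differ by a permutation of the
   variables. *)
Definition Symhat (k : fieldType) : set (seq nat -> k) :=
  [set F | QSymhat F /\ forall e e', perm_eq e e' -> F e = F e'].

Definition qsym_K (k : fieldType) (a : seq nat) : seq nat -> k :=
  lincomb
    [set b | composition (sumn a) b /\
      {subset comp_set a <= comp_set b ++ [seq i.+1 | i <- comp_set b]}]
    (fun b => 2%:R ^+ size b) (qsym_M k).

(* Linearity and continuity extend w |-> qsym_K (peak_comp w) to infinite
   combinations of packed words: the coefficient of x^e in the image of f
   involves only the finitely many packed words of length |e|. *)
Definition psi (k : fieldType) (f : seq nat -> k) : seq nat -> k :=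
  lincomb [set w | packed w] f (fun w => qsym_K k (peak_comp w)).

Lemma lincomb_qsym_M (k : fieldType) (A : set (seq nat)) (c : seq nat -> k) e :
  lincomb A c (qsym_M k) e =
  let b := [seq x <- e | x != 0%N] in if `[< A b >] then c b else 0.
Proof.
rewrite /lincomb; set b := [seq x <- e | _] => /=.
have M0 i : i <> b -> c i * qsym_M k i e = 0.
  rewrite /qsym_M -/b => ib.
  by have [E|_] := eqVneq b i; [case: ib | rewrite mulr0].
case: asboolP => [Ab|nAb].
  rewrite -(fsbig_widen [set b]) ?fsbig_set1 /=.
  - by rewrite /qsym_M -/b eqxx mulr1.
  - by move=> _ ->.
  - by move=> i [_ /M0].
by apply: fsbig1 => i Ai; apply: M0 => E; apply: nAb; rewrite -E.
Qed.

Lemma qsym_K_degree (k : fieldType) a e : qsym_K k a e != 0 -> sumn e = sumn a.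
Proof.
rewrite /qsym_K lincomb_qsym_M /=; case: asboolP; last by rewrite eqxx.
move=> [/andP[_ /eqP <-] _] _.
by elim: e => // -[|x] e IH //=; rewrite IH.
Qed.

Lemma packed_bound w : packed w -> all (fun a => 0 < a <= size w)%N w.
Proof.
move=> /eqP {2}<-; apply/allP => _ /mapP[a aw ->]; apply/andP; split.
  by rewrite -has_count; apply/hasP; exists a; rewrite ?mem_undup.
by rewrite (leq_trans (count_size _ _)) // size_undup.
Qed.
Lemma finite_packed n : finite_set [set w | packed w /\ size w = n].
Proof.
pose s := [seq map (@nat_of_ord n.+1) (tval t) |
  t <- enum {: n.-tuple 'I_n.+1}].
apply: sub_finite_set (finite_seq s).
move=> w [pw sw] /=.
have sz : size [seq (inord x : 'I_n.+1) | x <- w] == n by rewrite size_map sw.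
apply/mapP; exists (Tuple sz); rewrite ?mem_enum //= -map_comp.
rewrite -{1}[w]map_id; apply/eq_in_map => x xw /=.
have /allP/(_ x xw)/andP[_] := packed_bound pw.
by rewrite sw => h; rewrite inordK.
Qed.

Lemma psi_finite_support (k : fieldType) (f : seq nat -> k) e :
  finite_set [set w | packed w /\ f w * qsym_K k (peak_comp w) e != 0].
Proof.
apply: (sub_finite_set _ (finite_packed (sumn e))) => w [pw /=].
rewrite mulf_eq0 negb_or => /andP[_ /qsym_K_degree ->]; split=> //.
by have [/andP[_ /eqP <-] _] := peak_compP w.
Qed.

(* Main.v *)
Require Import Defs.
From mathcomp Require Import all_boot all_order all_algebra.
From mathcomp Require Import all_classical.
From mathcomp Require Import zify.

Set Implicit Arguments.
Unset Strict Implicit.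
Unset Printing Implicit Defensive.

Import GRing.Theory.
Local Open Scope nat_scope.

(** Everything happens in words of length four. A symmetric image has equal
    coefficients at x_1 x_2^3 and at x_1^3 x_2; since K_a contains M_(1,3)
    exactly when the peaks lie in {1, 2}, and M_(3,1) exactly when they lie in
    {3, 4}, this says that among the words of length four in any class, as many
    have their peak in position 2 as in position 3 ([peak_balance]).

    If 12 ~ 21, then any two letters commute and ~ extends Knuth equivalence.
    Otherwise, in any two equivalent words the restrictions to {a, a+1} cannot
    be ab and ba. Among permutations this leaves 1324 (peak 2) only 1342 and
    3142 as equivalent words with peak 3, and 1423 only 1243; restricting to
    {2, 3, 4} gives 213 ~ 231 and 132 ~ 312 ([permutation_relations]).

    These two relations pair off most of the words with three letters, and
    cancelling the pairs in the balance of a class leaves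
      #{1322, 1323, 2313, 2321, 3321} = #{1332, 1232, 2331, 3221, 3231},
    where #S counts the elements of S in the class ([three_letter_balance]).

    If 1 ~ 11, the pairs 1322 ~ 1332, 3321 ~ 3221 and 2313 ~ 2331 cancel as
    well. So the class of 1323 contains 1232 or 3231. The latter would restrict
    to 12 ~ 21, and the former restricts to 323 ~ 232: this is K-Knuth
    equivalence ([idempotent_case]).

    If not, then a letter that occurs once in a word cannot occur exactly twice
    in an equivalent word. The class of 1323 then yields 1332, whence 212 ~ 221; the class
    of 1322 yields 1232, whence 121 ~ 211 and Knuth equivalence, or 3221,
    whence 122 ~ 221. In that last case all the words on the two sides of the
    displayed equation pair off except 2321 and 1232, so these are equivalent,
    and the balance on two letters similarly gives 1211 ~ 1121: this is exotic
    Knuth equivalence ([nonidempotent_case]). *)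

(** * Words whose set of letters is an initial interval *)

Fixpoint words_over (m n : nat) : seq (seq nat) :=
  if n is n'.+1 then [seq a :: w | a <- iota 1 m, w <- words_over m n']
  else [:: [::]].

Definition surj_words (m n : nat) : seq (seq nat) :=
  [seq w <- words_over m n | all (fun a => a \in w) (iota 1 m)].

Lemma mem_words_over m n w :
  (w \in words_over m n) = (size w == n) && all (fun a => a \in iota 1 m) w.
Proof.
elim: n w => [|n IHn] [|a w] //=.
  by apply/negP => /allpairsP[[b v] []].
apply/allpairsP/idP => [[[b v] /= [bm vn [-> ->]]]|/and3P[sw am wm]].
  by move: vn; rewrite IHn bm eqSS => /andP[-> ->].
by exists (a, w); rewrite /= am IHn -eqSS sw wm.
Qed.

Lemma uniq_surj_words m n : uniq (surj_words m n).
Proof.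
apply: filter_uniq; elim: n => [|n IHn] //=.
apply: allpairs_uniq => //; first exact: iota_uniq.
by move=> [a v] [b w] _ _ /= [-> ->].
Qed.

Lemma mem_surj_words m n w : w \in surj_words m n <-> size w = n /\ w =i iota 1 m.
Proof.
rewrite mem_filter mem_words_over; split.
  case/and3P => /allP im /eqP sw /allP wm; split=> // a.
  by apply/idP/idP => [/wm|/im].
case=> -> wm; rewrite eqxx /=; apply/andP; split; apply/allP => a /=.
  by rewrite -wm.
by rewrite wm.
Qed.

Lemma initial_word m (w : seq nat) : w =i iota 1 m -> is_word w.
Proof. by move=> wm; apply/allP => a; rewrite wm mem_iota => /andP[]. Qed.

Lemma initial_packed m (w : seq nat) : w =i iota 1 m -> packed w.
Proof.
move=> wm; apply/eqP; rewrite -[RHS]map_id; apply/eq_in_map => a.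
rewrite wm mem_iota => /andP[a1 am].
have /permP -> : perm_eq (undup w) (iota 1 m).
  by apply: uniq_perm (undup_uniq _) (iota_uniq _ _) _ => b; rewrite mem_undup wm.
rewrite -[RHS](size_iota 1 a) -size_filter; congr (size _).
have -> : m = a + (m - a) by lia.
rewrite iotaD filter_cat (@eq_in_filter _ _ predT) ?filter_predT; last first.
  by move=> b; rewrite mem_iota /=; lia.
rewrite (@eq_in_filter _ _ pred0) ?filter_pred0 ?cats0 // => b.
by rewrite mem_iota /=; lia.
Qed.

(** * The balance between peaks in positions 2 and 3 *)

Definition peaks_near (i : nat) (w : seq nat) : bool :=
  all (fun j => j \in [:: i; i.+1]) (peaks w).

(** In two variables the only monomial quasi-symmetric function that contributes
    to x_1^i x_2^j is M_(i,j), whose descent set is {i}. *)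
Lemma qsym_K_two_variables (k : fieldType) w i j : 0 < i -> 0 < j ->
  (qsym_K k (peak_comp w) [:: i; j] =
   (4 * ((size w == i + j) && peaks_near i w))%:R)%R.
Proof.
move=> i0 j0; have [/andP[_ /eqP sz] cs] := peak_compP w.
rewrite /qsym_K lincomb_qsym_M sz cs /= -!lt0n i0 j0 /=.
case: asboolP => [[/andP[_ /=]]|].
  rewrite addn0 eq_sym => -> /= sub; rewrite /peaks_near.
  have -> : all (fun j0 => j0 \in [:: i; i.+1]) (peaks w).
    by apply/allP => a /sub; rewrite /comp_set /= addn0.
  by rewrite muln1 -natrX.
move=> H; case: eqP => [sw|_] /=; last by rewrite muln0.
case: (boolP (peaks_near i w)) => [/allP near|_]; last by rewrite muln0.
case: H; split; first by rewrite /composition /= i0 j0 sw addn0 eqxx.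
by move=> a /near; rewrite /comp_set /= addn0.
Qed.

Lemma natr_inj (k : fieldType) : [pchar k]%R =i pred0 ->
  injective (fun n => n%:R%R : k).
Proof.
move=> /pcharf0P k0 m n; wlog mn : m n / m <= n => [H|].
  by case/orP: (leq_total m n) => /H // H' /esym/H'.
by move=> /esym/eqP; rewrite -subr_eq0 -natrB // k0; lia.
Qed.

Section Symmetric.

Variables (k : fieldType) (R : seq nat -> seq nat -> Prop).
Hypothesis R_word : word_relation R.

(** The series of a class involves words of all lengths, but each coefficient of
    its image is a count over a finite list: homogeneity fixes the length, and
    equivalent words have the same letters. *)
Lemma psi_kappa m (u : seq nat) i j : u =i iota 1 m -> 0 < i -> 0 < j ->
  psi (kappa k [set v | is_word v /\ R u v])%classic [:: i; j] =
  (4 * count (fun v => `[< R u v >] && peaks_near i v) (surj_words m (i + j)))%:R%R.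
Proof.
move=> um i0 j0; have uw := initial_word um.
rewrite /psi /lincomb (fsbigE _ _ (uniq_surj_words m (i + j))) /=; first last.
- move=> v vp; apply: contraNeq; rewrite qsym_K_two_variables //.
  rewrite mulf_eq0 negb_or /kappa => /andP[].
  case: (boolP (v \in _)); rewrite ?eqxx // inE => -[vw Ruv] _.
  case: (size v =P i + j) => [sv _|_]; last by rewrite /= muln0 eqxx.
  by apply/mem_surj_words; split=> // a; rewrite -um (wrel_letters R_word uw vw Ruv).
- by move=> v /= /mem_surj_words[_]; apply: initial_packed.
rewrite -sum1_count natrM natr_sum big_distrr /=.
rewrite big_mkcond [RHS]big_mkcond; apply: eq_big_seq => v /mem_surj_words[sv vm] /=.
rewrite mem_set; last exact: initial_packed vm.
rewrite qsym_K_two_variables // sv eqxx /kappa /=.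
rewrite natrM mulrCA.
have -> : (v \in [set w | is_word w /\ R u w]%classic) = `[< R u v >].
  apply/idP/asboolP; rewrite inE; first by case.
  by split=> //; apply: initial_word vm.
by case: asboolP => _; case: (peaks_near i v); rewrite ?mul1r ?mul0r ?mulr1 ?mulr0.
Qed.

Lemma kappa_Khat (u : seq nat) : packed u ->
  Khat R (kappa k [set v | is_word v /\ R u v])%classic.
Proof.
move=> pu; set E := (X in kappa k X).
exists (fun F => (F == E)%:R%R); apply/funext => w; rewrite /lincomb.
rewrite (fsbigE _ _ (isT : uniq [:: E])) /=.
- rewrite big_mkcond big_seq1 eqxx mul1r mem_set //.
  by exists u.
- by move=> F /=; rewrite inE => /eqP ->; exists u.
- by move=> F _; rewrite inE => /negPf ->; rewrite mul0r.
Qed.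

Hypothesis k_char0 : [pchar k]%R =i pred0.
Hypothesis psi_sym : forall f : seq nat -> k, Khat R f -> Symhat (psi f).

(** Exchanging the two variables turns the condition on peaks for the coefficient
    of x_1^i x_2^j into the one for x_1^j x_2^i. *)
Lemma class_peak_symmetry m (u : seq nat) i j : u =i iota 1 m -> 0 < i -> 0 < j ->
  count (fun v => `[< R u v >] && peaks_near i v) (surj_words m (i + j)) =
  count (fun v => `[< R u v >] && peaks_near j v) (surj_words m (i + j)).
Proof.
move=> um i0 j0; have [_ sym] := psi_sym (kappa_Khat (initial_packed um)).
have := sym [:: i; j] [:: j; i] (permEl (perm_catC [:: i] [:: j])).
have k4 : (4%:R != 0 :> k)%R by rewrite (pcharf0P k).1.
by rewrite !(psi_kappa um) // [j + i]addnC !natrM => /(mulfI k4)/(natr_inj k_char0).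
Qed.

Definition peak_words (m i : nat) : seq (seq nat) :=
  [seq v <- surj_words m 4 | peaks v == [:: i]].

(** The case (i, j) = (1, 3). A word of length four has at most one peak, in
    position 2 or 3, and the words without a peak contribute to both sides. *)
Lemma peak_balance m u : u \in surj_words m 4 ->
  \sum_(v <- peak_words m 2) `[< R u v >] = \sum_(v <- peak_words m 3) `[< R u v >].
Proof.
move=> /mem_surj_words[_ um]; set s := surj_words m 4.
have near v : v \in s ->
    peaks_near 1 v = (peaks v == [::]) + (peaks v == [:: 2]) :> nat /\
    peaks_near 3 v = (peaks v == [::]) + (peaks v == [:: 3]) :> nat.
  case/mem_surj_words; case: v => [|a [|b [|c [|d []]]]] // _ _.
  rewrite /peaks_near /peaks /letter /=.
  by case: ifP => [/andP[ab cb]|_]; case: ifP => [/andP[bc dc]|_] //; lia.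
have split i j :
    {in s, forall v, peaks_near i v = (peaks v == [::]) + (peaks v == [:: j]) :> nat} ->
    count (fun v => `[< R u v >] && peaks_near i v) s =
    \sum_(v <- s | peaks v == [::]) `[< R u v >] + \sum_(v <- peak_words m j) `[< R u v >].
  rewrite big_filter -/s; elim: (s) => [|v r IHr] ij; first by rewrite !big_nil.
  rewrite !big_cons /= {}IHr => [|w wr]; last by apply: ij; rewrite inE wr orbT.
  have := ij v (mem_head v r).
  by case: `[< _ >]; case: peaks_near => /=; do 2 case: ifP => _ //; lia.
have := @class_peak_symmetry m u 1 3 um isT isT.
rewrite (split 1 2) ?(split 3 3); first exact: addnI.
  by move=> v /near[].
by move=> v /near[].
Qed.

End Symmetric.

(** * Consequences of a relation on words *)

Section Relation.

Variable R : seq nat -> seq nat -> Prop.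
Hypotheses (R_word : word_relation R) (R_ualg : uniformly_algebraic R).

Lemma rel_context x y v w : is_word x -> is_word y -> is_word v -> is_word w ->
  R v w -> R (x ++ v ++ y) (x ++ w ++ y).
Proof.
move=> xw yw vw ww Rvw; have refl := wrel_refl R_word.
apply: (ualg_cat R_ualg) => //; try by rewrite /is_word all_cat; apply/andP.
  exact: refl.
by apply: (ualg_cat R_ualg) => //; apply: refl.
Qed.

(** Restriction to the letters a+1, ..., b, renumbered from 1, so that relations
    between restrictions can be compared with those between packed words. *)
Definition window (a b : nat) (v : seq nat) : seq nat :=
  [seq x - a | x <- v & a < x <= b].

Lemma rel_window a b v w : is_word v -> is_word w ->
  R v w -> R (window a b v) (window a b w).
Proof.
move=> vw ww Rvw.
have filter_word u : is_word u -> is_word [seq x <- u | a < x <= b].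
  by move=> uw; rewrite /is_word all_filter; apply: sub_all uw => x /= ->; rewrite implybT.
apply: (ualg_map R_ualg); [exact: filter_word|exact: filter_word| |].
  have range x : in_range [seq y <- v | a < y <= b] x -> a < x.
    by case/andP=> /hasP[y]; rewrite mem_filter => /andP[/andP[ay _] _] /(leq_trans ay).
  by split=> [x /range|x y /range + _]; lia.
by apply: (ualg_filter R_ualg) => // x y z; lia.
Qed.

(** The increasing list s encodes the injection that sends i to the i-th entry
    of s. *)
Definition spread (s v : seq nat) : seq nat := [seq nth 0 (0 :: s) x | x <- v].

Lemma rel_spread s v w : R v w -> path ltn 0 s ->
  is_word v -> is_word w -> all (fun x => x <= size s) v ->
  [/\ is_word (spread s v), is_word (spread s w)
    & R (spread s v) (spread s w)].
Proof.
move=> Rvw s_inc vw ww vs.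
have inc : {in gtn (size s).+1 &, {homo nth 0 (0 :: s) : x y / x < y}}.
  by move=> x y xs ys; apply: (@sorted_ltn_nth _ _ ltn_trans 0 (0 :: s)).
have pos x : x \in v -> 0 < nth 0 (0 :: s) x.
  by move=> xv; apply: (inc 0 x) => //; [apply: (allP vs)|apply: (allP vw)].
have spread_word u : u =i v -> is_word (spread s u).
  by move=> uv; apply/allP => _ /mapP[x xu ->]; apply: pos; rewrite -uv.
split; [exact: spread_word| |].
  by apply: spread_word => x; rewrite (wrel_letters R_word vw ww Rvw).
apply: (ualg_map R_ualg) => //.
have range x : in_range v x -> 0 < x <= size s.
  case/andP=> /hasP[y yv yx] /hasP[z zv xz].
  by rewrite (leq_trans (allP vw _ yv) yx) (leq_trans xz (allP vs _ zv)).
split=> [x /range/andP[x0 xs]|x y /range/andP[_ xs] /range/andP[_ ys] xy].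
  exact: (inc 0 x).
exact: inc.
Qed.

(** A derivation may pass through any sequences, so the induction also shows that
    the closure preserves being a word: transitivity of R needs it for the middle
    term. *)
Lemma extends_closure (G : seq nat -> seq nat -> Prop) :
  (forall v w, G v w -> [/\ is_word v, is_word w & R v w]) ->
  extends R (congruence_closure G).
Proof.
move=> GR v w vw _ cc.
suff : is_word v = is_word w /\ (is_word v -> R v w) by case=> _; apply.
elim: cc {vw} => {v w} [v w /GR[-> ->]|v|v w _ [E H]|u v w _ [E H] _ [E' H']|].
- by [].
- by split=> // /(wrel_refl R_word).
- by split=> // ww; apply: (wrel_sym R_word); rewrite ?E //; apply: H; rewrite E.
- split=> [|uw]; first by rewrite E.
  by apply: (wrel_trans R_word) (H uw) (H' _); rewrite -?E' -?E.
- move=> v v' w w' _ [E H] _ [E' H']; split.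
    by rewrite /is_word !all_cat -!/(is_word _) E E'.
  rewrite /is_word all_cat => /andP[vw ww].
  by apply: (ualg_cat R_ualg); rewrite -?E -?E' //; [apply: H|apply: H'].
Qed.

(** Every generating relation between words on the letters a < b < c is the image
    under an increasing injection of one between words on 1, 2, 3, so that
    finitely many relations suffice. *)
Lemma extends_knuth_of :
  R [:: 2; 1; 3] [:: 2; 3; 1] -> R [:: 1; 3; 2] [:: 3; 1; 2] ->
  R [:: 1; 2; 1] [:: 2; 1; 1] -> R [:: 2; 1; 2] [:: 2; 2; 1] ->
  extends R knuth.
Proof.
move=> h213 h132 h121 h212; apply: extends_closure => v w [].
- by move=> a b c a0 ab bc; apply: (rel_spread (s := [:: a; b; c]) h213); rewrite //= a0 ab bc.
- by move=> a b c a0 ab bc; apply: (rel_spread (s := [:: a; b; c]) h132); rewrite //= a0 ab bc.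
- by move=> a b a0 ab; apply: (rel_spread (s := [:: a; b]) h121); rewrite //= a0 ab.
- by move=> a b a0 ab; apply: (rel_spread (s := [:: a; b]) h212); rewrite //= a0 ab.
Qed.

Lemma extends_Kknuth_of :
  R [:: 2; 1; 3] [:: 2; 3; 1] -> R [:: 1; 3; 2] [:: 3; 1; 2] ->
  R [:: 1; 2; 1] [:: 2; 1; 2] -> R [:: 1] [:: 1; 1] ->
  extends R Kknuth.
Proof.
move=> h213 h132 h121 h1; apply: extends_closure => v w [].
- by move=> a b c a0 ab bc; apply: (rel_spread (s := [:: a; b; c]) h213); rewrite //= a0 ab bc.
- by move=> a b c a0 ab bc; apply: (rel_spread (s := [:: a; b; c]) h132); rewrite //= a0 ab bc.
- by move=> a b a0 ab; apply: (rel_spread (s := [:: a; b]) h121); rewrite //= a0 ab.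
- by move=> a a0; apply: (rel_spread (s := [:: a]) h1); rewrite //= a0.
Qed.

(** The relations xyzy ~ yzyx come from two patterns: 1121 ~ 1211 if x = y, and
    1232 ~ 2321 if x < y. *)
Lemma extends_exotic_of :
  R [:: 2; 1; 3] [:: 2; 3; 1] -> R [:: 1; 3; 2] [:: 3; 1; 2] ->
  R [:: 2; 2; 1] [:: 2; 1; 2] -> R [:: 2; 1; 2] [:: 1; 2; 2] ->
  R [:: 1; 1; 2; 1] [:: 1; 2; 1; 1] -> R [:: 1; 2; 3; 2] [:: 2; 3; 2; 1] ->
  extends R exotic_knuth.
Proof.
move=> h213 h132 h221 h212 h1121 h1232; apply: extends_closure => v w [].
- by move=> a b c a0 ab bc; apply: (rel_spread (s := [:: a; b; c]) h213); rewrite //= a0 ab bc.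
- by move=> a b c a0 ab bc; apply: (rel_spread (s := [:: a; b; c]) h132); rewrite //= a0 ab bc.
- by move=> a b a0 ab; apply: (rel_spread (s := [:: a; b]) h221); rewrite //= a0 ab.
- by move=> a b a0 ab; apply: (rel_spread (s := [:: a; b]) h212); rewrite //= a0 ab.
- move=> x y z x0; rewrite leq_eqVlt => /predU1P[<-|xy] yz.
    by apply: (rel_spread (s := [:: x; z]) h1121); rewrite //= x0 yz.
  by apply: (rel_spread (s := [:: x; y; z]) h1232); rewrite //= x0 xy yz.
Qed.

Lemma swap_extends_knuth : R [:: 1; 2] [:: 2; 1] -> extends R knuth.
Proof.
move=> h12.
have [_ _ h13] := rel_spread (s := [:: 1; 3]) h12 isT isT isT isT.
apply: extends_knuth_of.
- exact: (rel_context (x := [:: 2]) (y := [::])) h13.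
- exact: (rel_context (x := [::]) (y := [:: 2])) h13.
- exact: (rel_context (x := [::]) (y := [:: 1])) h12.
- exact: (rel_context (x := [:: 2]) (y := [::])) h12.
Qed.

(** Whether a word belongs to the class of u is unchanged when a factor v of it
    is replaced by an equivalent factor w. *)
Lemma class_replace u x y v w : is_word u -> is_word x -> is_word y ->
  is_word v -> is_word w -> R v w ->
  `[< R u (x ++ v ++ y) >] = `[< R u (x ++ w ++ y) >].
Proof.
move=> uw xw yw vw ww Rvw; have h := rel_context xw yw vw ww Rvw.
have cat_word z : is_word z -> is_word (x ++ z ++ y).
  by move=> zw; rewrite /is_word !all_cat; apply/and3P.
apply/asboolP/asboolP => Ru; first by apply: (wrel_trans R_word) Ru h; rewrite ?cat_word.
by apply: (wrel_trans R_word) Ru (wrel_sym R_word _ _ h); rewrite ?cat_word.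
Qed.

End Relation.

(** * Relations of length at most four forced by the balance *)

Section Balanced.

Variables (k : fieldType) (R : seq nat -> seq nat -> Prop).
Hypothesis k_char0 : [pchar k]%R =i pred0.
Hypotheses (R_word : word_relation R) (R_ualg : uniformly_algebraic R).
Hypothesis psi_sym : forall f : seq nat -> k, Khat R f -> Symhat (psi f).
Hypothesis no_swap : ~ R [:: 1; 2] [:: 2; 1].

Let balance := peak_balance R_word k_char0 psi_sym.

(** A computable obstruction to v ~ w when 12 and 21 are not equivalent; the range
    of a covers the pairs of consecutive letters up to 4. *)
Definition swapped (v w : seq nat) : bool :=
  has (fun a => let p := (window a a.+2 v, window a a.+2 w) in
    (p == ([:: 1; 2], [:: 2; 1])) || (p == ([:: 2; 1], [:: 1; 2]))) (iota 0 3).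

Lemma related_not_swapped v w : R v w -> is_word v -> is_word w -> ~~ swapped v w.
Proof.
move=> Rvw vw ww; apply/hasPn => a _ /=; have := rel_window R_ualg a a.+2 vw ww Rvw.
apply: contraPN => /orP[] /eqP[-> ->] //.
by move=> h; apply: no_swap; apply: (wrel_sym R_word).
Qed.

Lemma peak_partner m u : u \in peak_words m 2 ->
  exists2 v, v \in [seq v <- peak_words m 3 | ~~ swapped u v] & R u v.
Proof.
move=> u2; have us : u \in surj_words m 4 by move: u2; rewrite mem_filter => /andP[].
have uw : is_word u by case/mem_surj_words: us => _; apply: initial_word.
have sum2 : 0 < \sum_(v <- peak_words m 2) `[< R u v >].
  by rewrite (big_rem u) //= asboolT //; apply: (wrel_refl R_word).
have /hasP[v v3 /asboolP Ruv] : has (fun v => `[< R u v >]) (peak_words m 3).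
  by rewrite has_count -sum1_count big_mkcond; move: sum2; rewrite balance.
have vw : is_word v.
  by move: v3; rewrite mem_filter => /andP[_ /mem_surj_words[_ /initial_word]].
by exists v => //; rewrite mem_filter related_not_swapped.
Qed.

Lemma peak_words_2_2 :
  peak_words 2 2 =
  [:: [:: 1; 2; 1; 1]; [:: 1; 2; 1; 2]; [:: 2; 2; 1; 1]; [:: 2; 2; 1; 2]].
Proof. by []. Qed.

Lemma peak_words_2_3 :
  peak_words 2 3 =
  [:: [:: 1; 1; 2; 1]; [:: 1; 2; 2; 1]; [:: 2; 1; 2; 1]; [:: 2; 2; 2; 1]].
Proof. by []. Qed.

Lemma peak_words_3_2 :
  peak_words 3 2 =
  [:: [:: 1; 2; 1; 3]; [:: 1; 3; 1; 2]; [:: 1; 3; 2; 1]; [:: 1; 3; 2; 2];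
      [:: 1; 3; 2; 3]; [:: 2; 2; 1; 3]; [:: 2; 3; 1; 1]; [:: 2; 3; 1; 2];
      [:: 2; 3; 1; 3]; [:: 2; 3; 2; 1]; [:: 3; 3; 1; 2]; [:: 3; 3; 2; 1]].
Proof. by []. Qed.

Lemma peak_words_3_3 :
  peak_words 3 3 =
  [:: [:: 1; 1; 3; 2]; [:: 1; 2; 3; 1]; [:: 1; 2; 3; 2]; [:: 1; 3; 3; 2];
      [:: 2; 1; 3; 1]; [:: 2; 1; 3; 2]; [:: 2; 2; 3; 1]; [:: 2; 3; 3; 1];
      [:: 3; 1; 2; 1]; [:: 3; 1; 3; 2]; [:: 3; 2; 2; 1]; [:: 3; 2; 3; 1]].
Proof. by []. Qed.

(** For a permutation u the order of the letters a and a+1 is the same in all the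
    equivalent words, which leaves so few partners with peak 3 that they all
    agree on the letters 2, 3, 4. *)
Lemma permutation_relations :
  R [:: 2; 1; 3] [:: 2; 3; 1] /\ R [:: 1; 3; 2] [:: 3; 1; 2].
Proof.
have restrict v w : is_word v -> is_word w -> R v w -> R (window 1 4 v) (window 1 4 w).
  exact: rel_window.
split.
  have [v] := peak_partner (isT : [:: 1; 3; 2; 4] \in peak_words 4 2).
  have -> : [seq v <- peak_words 4 3 | ~~ swapped [:: 1; 3; 2; 4] v] =
    [:: [:: 1; 3; 4; 2]; [:: 3; 1; 4; 2]] by [].
  by rewrite !inE => /orP[] /eqP-> /restrict; apply.
have [v] := peak_partner (isT : [:: 1; 4; 2; 3] \in peak_words 4 2).
have -> : [seq v <- peak_words 4 3 | ~~ swapped [:: 1; 4; 2; 3] v] =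
  [:: [:: 1; 2; 4; 3]] by [].
rewrite !inE => /eqP-> /restrict h; apply: (wrel_sym R_word) => //.
exact: h.
Qed.

Let h213 := permutation_relations.1.
Let h132 := permutation_relations.2.

(** The cancelled pairs are 1213 ~ 1231, 2131 ~ 2311, 2213 ~ 2231, 2132 ~ 2312,
    1132 ~ 1312, 1321 ~ 3121 and 3132 ~ 3312. *)
Lemma three_letter_balance u : u \in surj_words 3 4 ->
  `[< R u [:: 1; 3; 2; 2] >] + `[< R u [:: 1; 3; 2; 3] >] + `[< R u [:: 2; 3; 1; 3] >]
    + `[< R u [:: 2; 3; 2; 1] >] + `[< R u [:: 3; 3; 2; 1] >] =
  `[< R u [:: 1; 3; 3; 2] >] + `[< R u [:: 1; 2; 3; 2] >] + `[< R u [:: 2; 3; 3; 1] >]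
    + `[< R u [:: 3; 2; 2; 1] >] + `[< R u [:: 3; 2; 3; 1] >].
Proof.
move=> us; have uw : is_word u by case/mem_surj_words: us => _; apply: initial_word.
have := balance us; rewrite peak_words_3_2 peak_words_3_3 !big_cons !big_nil.
have cat x y v w := @class_replace R R_word R_ualg u x y v w uw.
rewrite (cat [:: 1] [::] [:: 2; 1; 3] [:: 2; 3; 1]) //.
rewrite (cat [::] [:: 1] [:: 2; 1; 3] [:: 2; 3; 1]) //.
rewrite (cat [:: 2] [::] [:: 2; 1; 3] [:: 2; 3; 1]) //.
rewrite (cat [::] [:: 2] [:: 2; 1; 3] [:: 2; 3; 1]) //.
rewrite (cat [:: 1] [::] [:: 1; 3; 2] [:: 3; 1; 2]) //.
rewrite (cat [::] [:: 1] [:: 1; 3; 2] [:: 3; 1; 2]) //.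
rewrite (cat [:: 3] [::] [:: 1; 3; 2] [:: 3; 1; 2]) //.
(* With the values of the indicator function abstract, the arithmetic is linear
   and avoids a case split on each of them. *)
pose f v := nat_of_bool `[< R u v >]; rewrite /= -!/(f _); clearbody f; lia.
Qed.

(** In the class of 1323 three more pairs of words cancel, and the word 1323
    itself must be balanced by 1232 or 3231. *)
Lemma idempotent_case : R [:: 1] [:: 1; 1] -> R [:: 1; 2; 1] [:: 2; 1; 2].
Proof.
move=> h1.
have [_ _ h2] := rel_spread R_word R_ualg (s := [:: 2]) h1 isT isT isT isT.
have [_ _ h3] := rel_spread R_word R_ualg (s := [:: 3]) h1 isT isT isT isT.
pose u := [:: 1; 3; 2; 3].
have cat x y v w := @class_replace R R_word R_ualg u x y v w isT.
have := @three_letter_balance u isT.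
(* Both 1322 and 1332 collapse to 132, and both 3321 and 3221 to 321. *)
rewrite -(cat [:: 1; 3] [::] [:: 2] [:: 2; 2]) // (cat [:: 1] [:: 2] [:: 3] [:: 3; 3]) //.
rewrite -(cat [::] [:: 2; 1] [:: 3] [:: 3; 3]) // (cat [:: 3] [:: 1] [:: 2] [:: 2; 2]) //.
(* The chain 2313 ~ 2133 ~ 213 ~ 231 ~ 2331. *)
rewrite -(cat [::] [:: 3] [:: 2; 1; 3] [:: 2; 3; 1]) //.
rewrite -(cat [:: 2; 1] [::] [:: 3] [:: 3; 3]) //.
rewrite (cat [::] [::] [:: 2; 1; 3] [:: 2; 3; 1]) //.
rewrite (cat [:: 2] [:: 1] [:: 3] [:: 3; 3]) //.
rewrite (asboolT (wrel_refl R_word (isT : is_word u))) /=.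
case: (asboolP (R u [:: 1; 2; 3; 2])) => [h _|_].
  by apply: (wrel_sym R_word) => //; apply: (rel_window R_ualg 1 3 _ _ h).
case: (asboolP (R u [:: 3; 2; 3; 1])) => [/related_not_swapped/(_ isT isT)//|_].
pose f v := nat_of_bool `[< R u v >]; rewrite -!/(f _); clearbody f; lia.
Qed.

(** If 2 occurs once in a word, it cannot occur exactly twice in an equivalent
    one, as the restrictions to the letter 2 would give 1 ~ 11; this and the order
    of 1 and 2 exclude most partners of 1323 and 1322. *)
Lemma nonidempotent_case : ~ R [:: 1] [:: 1; 1] ->
  R [:: 2; 1; 2] [:: 2; 2; 1] /\
  (R [:: 1; 2; 1] [:: 2; 1; 1] \/
   [/\ R [:: 1; 2; 2] [:: 2; 2; 1], R [:: 1; 1; 2; 1] [:: 1; 2; 1; 1]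
     & R [:: 1; 2; 3; 2] [:: 2; 3; 2; 1]]).
Proof.
move=> n11; have n11' : ~ R [:: 1; 1] [:: 1].
  by move=> h; apply: n11; apply: (wrel_sym R_word).
have twos u v : R u v -> is_word u -> is_word v -> R (window 1 2 u) (window 1 2 v).
  by move=> h uw vw; apply: rel_window.
have h212 : R [:: 2; 1; 2] [:: 2; 2; 1].
  have := @three_letter_balance [:: 1; 3; 2; 3] isT; set u := [:: 1; 3; 2; 3].
  rewrite (asboolT (wrel_refl R_word (isT : is_word u))).
  case: (asboolP (R u [:: 1; 3; 3; 2])) => [h _|_].
    exact: (rel_window R_ualg 1 3 _ _ h).
  case: (asboolP (R u [:: 1; 2; 3; 2])) => [/twos/(_ isT isT)/n11//|_].
  case: (asboolP (R u [:: 2; 3; 3; 1])) => [/related_not_swapped/(_ isT isT)//|_].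
  case: (asboolP (R u [:: 3; 2; 2; 1])) => [/twos/(_ isT isT)/n11//|_].
  case: (asboolP (R u [:: 3; 2; 3; 1])) => [/related_not_swapped/(_ isT isT)//|_].
  lia.
have [_ _ h323] := rel_spread R_word R_ualg (s := [:: 2; 3]) h212 isT isT isT isT.
have [_ _ h313] := rel_spread R_word R_ualg (s := [:: 1; 3]) h212 isT isT isT isT.
split=> //.
have [h121|h122] : R [:: 1; 2; 1] [:: 2; 1; 1] \/ R [:: 1; 2; 2] [:: 2; 2; 1].
  have := @three_letter_balance [:: 1; 3; 2; 2] isT; set u := [:: 1; 3; 2; 2].
  rewrite (asboolT (wrel_refl R_word (isT : is_word u))).
  case: (asboolP (R u [:: 1; 3; 3; 2])) => [/twos/(_ isT isT)/n11'//|_].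
  case: (asboolP (R u [:: 1; 2; 3; 2])) => [h _|_].
    by left; apply: (wrel_sym R_word) => //; apply: (rel_window R_ualg 1 3 _ _ h).
  case: (asboolP (R u [:: 2; 3; 3; 1])) => [/twos/(_ isT isT)/n11'//|_].
  case: (asboolP (R u [:: 3; 2; 2; 1])) => [h _|_].
    by right; apply: (rel_window R_ualg 0 2 _ _ h).
  case: (asboolP (R u [:: 3; 2; 3; 1])) => [/twos/(_ isT isT)/n11'//|_].
  lia.
  by left.
right; split=> //.
  have := @balance 2 [:: 1; 2; 1; 1] isT; set u := [:: 1; 2; 1; 1].
  have cat x y v w := @class_replace R R_word R_ualg u x y v w isT.
  rewrite peak_words_2_2 peak_words_2_3 !big_cons !big_nil.
  rewrite (cat [:: 1] [::] [:: 2; 1; 2] [:: 2; 2; 1]) //.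
  rewrite -(cat [::] [:: 1] [:: 2; 1; 2] [:: 2; 2; 1]) //.
  rewrite (cat [:: 2] [::] [:: 2; 1; 2] [:: 2; 2; 1]) //.
  rewrite (asboolT (wrel_refl R_word (isT : is_word u))).
  case: (asboolP (R u [:: 1; 1; 2; 1])) => [h _|_]; first exact: (wrel_sym R_word).
  pose f v := nat_of_bool `[< R u v >]; rewrite /= -!/(f _); clearbody f; lia.
have := @three_letter_balance [:: 2; 3; 2; 1] isT; set u := [:: 2; 3; 2; 1].
have cat x y v w := @class_replace R R_word R_ualg u x y v w isT.
(* The chain 1322 ~ 3122 ~ 3221, then 1323 ~ 1332, 2313 ~ 2331, 3231 ~ 3321. *)
rewrite (cat [::] [:: 2] [:: 1; 3; 2] [:: 3; 1; 2]) //.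
rewrite (cat [:: 3] [::] [:: 1; 2; 2] [:: 2; 2; 1]) //.
rewrite (cat [:: 1] [::] [:: 3; 2; 3] [:: 3; 3; 2]) //.
rewrite (cat [:: 2] [::] [:: 3; 1; 3] [:: 3; 3; 1]) //.
rewrite -(cat [::] [:: 1] [:: 3; 2; 3] [:: 3; 3; 2]) //.
rewrite (asboolT (wrel_refl R_word (isT : is_word u))).
case: (asboolP (R u [:: 1; 2; 3; 2])) => [h _|_]; first exact: (wrel_sym R_word).
pose f v := nat_of_bool `[< R u v >]; rewrite /= -!/(f _); clearbody f; lia.
Qed.

End Balanced.

Theorem proposition8p16 (k : fieldType) (R : seq nat -> seq nat -> Prop)
  (k_char0 : [pchar k]%R =i pred0)
  (R_word : word_relation R) (R_ualg : uniformly_algebraic R)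
  (psi_sym : forall f : seq nat -> k, Khat R f -> Symhat (psi f)) :
  extends R knuth \/ extends R Kknuth \/ extends R exotic_knuth.
Proof.
have [h12|no_swap] := pselect (R [:: 1; 2] [:: 2; 1]).
  by left; apply: swap_extends_knuth.
have [h213 h132] := permutation_relations k_char0 R_word R_ualg psi_sym no_swap.
have [h1|n1] := pselect (R [:: 1] [:: 1; 1]).
  right; left; apply: extends_Kknuth_of => //.
  exact: (idempotent_case k_char0 R_word R_ualg psi_sym no_swap).
have [h212 [h121|[h122 h1121 h1232]]] :=
  nonidempotent_case k_char0 R_word R_ualg psi_sym no_swap n1.
  by left; apply: extends_knuth_of.
have h221 : R [:: 2; 2; 1] [:: 2; 1; 2] by apply: (wrel_sym R_word).
right; right; apply: extends_exotic_of => //.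
apply: (wrel_sym R_word) => //.
exact: (wrel_trans R_word _ _ _ h122 h221).
Qed.
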